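(* Fix $\lambda\ge0$, integers $n,m\ge1$, $N=n+m$, points $Z_i=(X_i,W_i)\in\mathcal Z=\mathcal X\times\mathcal W$ for $i=1,\dots,N$ and responses $Y_1,\dots,Y_n\in\mathbb R$. Let $\mathcal D_f$ be a finite symmetric dictionary of functions on $\mathcal X$ with $\|\psi\|_{L^2(\hat P_N^X)}\le1$ for all $\psi\in\mathcal D_f$, and $\mathcal D_g$ a finite symmetric dictionary of functions on $\mathcal Z$ with $\|\phi\|_{L^2(\hat P_N^Z)}\le1$ for all $\phi\in\mathcal D_g$. Define $$\hat{\mathcal L}(f,g;\lambda)=\frac1N\Big(\sum_{i=1}^n(Y_i-f(X_i))^2+\sum_{j=n+1}^N(g(Z_j)-f(X_j))^2+\lambda\sum_{i=1}^n(Y_i-g(Z_i))^2\Big).$$ Consider the Alternating Forward Selection algorithm: initialize $g_0=0$; for $k=1,2,\dots$, (1) choose $(\psi_k,f_k)\in\arg\min\big\{\frac1N\big(\sum_{i=1}^n(Y_i-f(X_i))^2+\sum_{j=n+1}^N(g_{k-1}(Z_j)-f(X_j))^2\big):\psi\in\mathcal D_f,\ f\in\mathrm{span}(\psi_1,\dots,\psi_{k-1},\psi)\big\}$; (2) choose $(\phi_k,g_k)\in\arg\min\big\{\frac1N\big(\sum_{j=n+1}^N(g(Z_j)-f_k(X_j))^2+\lambda\sum_{i=1}^n(Y_i-g(Z_i))^2\big):\phi\in\mathcal D_g,\ g\in\mathrm{span}(\phi_1,\dots,\phi_{k-1},\phi)\big\}$. Then for all $k\ge1$ and all $f\in\mathrm{span}(\mathcal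 D_f)$, $g\in\mathrm{span}(\mathcal D_g)$, $$\hat{\mathcal L}(f_k,g_k;\lambda)\le\hat{\mathcal L}(f,g;\lambda)+C_2\frac{\max\{1,\lambda\}\big(\|f\|_{L^1(\mathcal D_f)}+\|g\|_{L^1(\mathcal D_g)}\big)^2\log(k+1)}{k}$$ for a universal constant $C_2>0$.
   Context: $\hat P_N^X$ and $\hat P_N^Z$ are the empirical measures of $x_1,\dots,x_N$ and $z_1,\dots,z_N$; $\|h\|_{L^2(\hat P_N^X)}^2=\frac1N\sum_{i=1}^N h(X_i)^2$, and similarly on $\mathcal Z$. A dictionary is symmetric if $\psi\in\mathcal D$ implies $-\psi\in\mathcal D$. Atomic norms: $\|f\|_{L^1(\mathcal D_f)}=\inf\{\sum_{\psi\in\mathcal D_f}|c_\psi|: f=\sum_{\psi\in\mathcal D_f}c_\psi\psi\}$, and analogously $\|g\|_{L^1(\mathcal D_g)}$. *)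

(* Defs.v *)
From HB Require Import structures.
From mathcomp Require Import all_boot all_order all_algebra.
From mathcomp Require Import all_classical all_reals all_analysis.
Set Implicit Arguments. Unset Strict Implicit. Unset Printing Implicit Defensive.
Import Order.TTheory GRing.Theory Num.Theory.
Local Open Scope classical_set_scope.
Local Open Scope ring_scope.

Definition emp_norm (R : realType) (T : Type) (N : nat) (pts : nat -> T)
  (h : T -> R) : R :=
  Num.sqrt (N%:R^-1 * \sum_(i < N) (h (pts i)) ^+ 2).

(* A finite dictionary is a finite family D : 'I_p -> (T -> R).
   Symmetric: psi in D implies -psi in D. *)
Definition symmetric_dict (R : realType) (T : Type) (p : nat)
  (D : 'I_p -> T -> R) : Prop :=
  forall i, exists j, D j = (fun x => - D i x).

Definition lincomb (R : realType) (T : Type) (p : nat)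
  (D : 'I_p -> T -> R) (c : 'I_p -> R) : T -> R :=
  fun x => \sum_(i < p) c i * D i x.

Definition in_span (R : realType) (T : Type) (p : nat)
  (D : 'I_p -> T -> R) (f : T -> R) : Prop :=
  exists c, f = lincomb D c.

Definition atomic_norm (R : realType) (T : Type) (p : nat)
  (D : 'I_p -> T -> R) (f : T -> R) : R :=
  inf [set s : R | exists c : 'I_p -> R,
         f = lincomb D c /\ s = \sum_(i < p) `|c i|].

Definition seq_span (R : realType) (T : Type) (l : seq (T -> R))
  (f : T -> R) : Prop :=
  exists c : nat -> R,
    f = (fun x => \sum_(j < size l) c j * (nth (fun _ => 0) l j) x).

(* Indexing convention (0-based): labelled samples are i = 0..n-1,
   unlabelled samples are j = n..n+m-1; Z_i = (X_i, W_i); N = n + m. *)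

Definition loss_f (R : realType) (X W : Type) (n m : nat)
  (Xs : nat -> X) (Ws : nat -> W) (Ys : nat -> R)
  (g : X * W -> R) (f : X -> R) : R :=
  (n + m)%:R^-1 *
    (\sum_(0 <= i < n) (Ys i - f (Xs i)) ^+ 2
     + \sum_(n <= j < n + m) (g (Xs j, Ws j) - f (Xs j)) ^+ 2).

Definition loss_g (R : realType) (X W : Type) (n m : nat) (lam : R)
  (Xs : nat -> X) (Ws : nat -> W) (Ys : nat -> R)
  (f : X -> R) (g : X * W -> R) : R :=
  (n + m)%:R^-1 *
    (\sum_(n <= j < n + m) (g (Xs j, Ws j) - f (Xs j)) ^+ 2
     + lam * \sum_(0 <= i < n) (Ys i - g (Xs i, Ws i)) ^+ 2).

Definition Lhat (R : realType) (X W : Type) (n m : nat) (lam : R)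
  (Xs : nat -> X) (Ws : nat -> W) (Ys : nat -> R)
  (f : X -> R) (g : X * W -> R) : R :=
  (n + m)%:R^-1 *
    (\sum_(0 <= i < n) (Ys i - f (Xs i)) ^+ 2
     + \sum_(n <= j < n + m) (g (Xs j, Ws j) - f (Xs j)) ^+ 2
     + lam * \sum_(0 <= i < n) (Ys i - g (Xs i, Ws i)) ^+ 2).

(* The sequences (psi_k = Df (sf k), f_k = fs k, phi_k = Dg (sg k), g_k = gs k),
   k >= 1, with g_0 = 0, are a run of Alternating Forward Selection:
   at each step the chosen pair is an argmin of the stated objective. *)
Definition AFS_run (R : realType) (X W : Type) (n m : nat) (lam : R)
  (Xs : nat -> X) (Ws : nat -> W) (Ys : nat -> R)
  (pf : nat) (Df : 'I_pf -> X -> R) (pg : nat) (Dg : 'I_pg -> X * W -> R)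
  (sf : nat -> 'I_pf) (fs : nat -> X -> R)
  (sg : nat -> 'I_pg) (gs : nat -> X * W -> R) : Prop :=
  gs 0%N = (fun _ => 0) /\
  forall k : nat, (0 < k)%N ->
    (seq_span (rcons [seq Df (sf j) | j <- iota 1 k.-1] (Df (sf k))) (fs k) /\
     forall (i : 'I_pf) (f : X -> R),
       seq_span (rcons [seq Df (sf j) | j <- iota 1 k.-1] (Df i)) f ->
       loss_f n m Xs Ws Ys (gs k.-1) (fs k) <= loss_f n m Xs Ws Ys (gs k.-1) f)
    /\
    (seq_span (rcons [seq Dg (sg j) | j <- iota 1 k.-1] (Dg (sg k))) (gs k) /\
     forall (i : 'I_pg) (g : X * W -> R),
       seq_span (rcons [seq Dg (sg j) | j <- iota 1 k.-1] (Dg i)) g ->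
       loss_g n m lam Xs Ws Ys (fs k) (gs k) <= loss_g n m lam Xs Ws Ys (fs k) g).

(* Main.v *)
Require Import Defs.
From HB Require Import structures.
From mathcomp Require Import all_boot all_order all_algebra.
From mathcomp Require Import all_classical all_reals all_analysis.
From mathcomp Require Import ring lra.
Set Implicit Arguments. Unset Strict Implicit. Unset Printing Implicit Defensive.
Import Order.TTheory GRing.Theory Num.Theory.
Local Open Scope ring_scope.

(* Write [d_j] for the excess loss of [(f_j, g_j)] over the comparison point
   [(f, g)], [E_j] for the squared distance from [g_j] to [g], [M] for the sum of
   the l1-norms of representations of [f] and [g], and [P = M sqrt(max(1, lam))].
   Greedy selection makes the partial gradients at step [j], tested against the
   atoms, at most of order [sqrt(d_j - d_{j+1})], while orthogonality of the
   partial minimizers kills their components along the iterates.  Inserting this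
   into the three- and four-point inequalities of alternating minimization gives
     d_{j+1} + E_{j+1} <= E_j
       + 4 P (sqrt(d_j - d_{j+1}) + sqrt(d_{j+1} - d_{j+2})).
   After summation, AM-GM with weights [j+1] bounds the square roots by
   [sum_j (j+1)(d_j - d_{j+1}) / 2 + 32 P^2 sum_j 1/(j+1)]; by Abel summation the
   first term is absorbed, and the harmonic sum is the source of the logarithm. *)

(** * Harmonic sums and perturbed descent of real sequences *)

Lemma harmonic_le_ln (R : realType) (k : nat) :
  \sum_(j < k) (j.+1%:R : R)^-1 <= 2 * ln k.+1%:R.
Proof.
elim: k => [|k IHk]; first by rewrite big_ord0 ln1 mulr0.
rewrite big_ord_recr /=.
have k1 : 0 < (k.+1%:R : R) by rewrite ltr0n.
have k2 : 0 < (k.+2%:R : R) by rewrite ltr0n.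
have : ln (k.+1%:R / k.+2%:R) <= - (k.+2%:R : R)^-1.
  have -> : k.+1%:R / k.+2%:R = 1 + - (k.+2%:R)^-1 :> R.
    by rewrite -[k.+1%:R](addrK 1) natr1 mulrDl divff ?gt_eqF // mulN1r.
  by apply: le_ln1Dx; rewrite ltrN2 invf_lt1 // ltr1n.
rewrite ln_div ?posrE // => lnk.
(* Source of the factor 2: the logarithm grows by at least [1/(k+2)], while the sum gains
   [1/(k+1)]. *)
have : (k.+1%:R : R)^-1 <= 2 * (k.+2%:R)^-1.
  by rewrite ler_pdivlMr // ler_pdivrMl // -natrM ler_nat muln2
    -addnn addSn addnS !ltnS leq_addr.
move=> kk; apply: le_trans (lerD IHk kk) _.
by rewrite -mulrDr ler_wpM2l // -lerBrDl -lerN2 opprB.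
Qed.

Lemma perturbed_descent_rate (R : realType) (d E : nat -> R) (P : R) :
  0 <= P -> (forall j, d j.+1 <= d j) -> (forall j, 0 <= E j) ->
  E 0%N <= P ^+ 2 ->
  d 0%N <= 4 * P * Num.sqrt (d 0%N - d 1%N) ->
  (forall j, d j.+1 + E j.+1 <= E j + 4 * P *
     (Num.sqrt (d j - d j.+1) + Num.sqrt (d j.+1 - d j.+2))) ->
  forall k, (0 < k)%N -> k%:R * d k <= 66 * P ^+ 2 * ln k.+1%:R.
Proof.
move=> P0 dd E0 E0P d0 dS [//|k] _.
set q := fun j => Num.sqrt (d j - d j.+1).
have q0 j : 0 <= q j by exact: sqrtr_ge0.
have qq j : q j ^+ 2 = d j - d j.+1 by rewrite sqr_sqrtr // subr_ge0.
(* Each square root enters two consecutive inequalities, whence [8 * P * q j]; [4 * P * q n] on the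
   left is the share of [q n] not yet spent. *)
have tele n : \sum_(j < n.+1) d j + E n + 4 * P * q n <=
    E 0%N + \sum_(j < n.+1) 8 * P * q j.
  elim: n => [|n IHn].
    rewrite !big_ord1 /=; move: d0; rewrite -/(q 0%N); lra.
  rewrite big_ord_recr [X in _ <= _ + X]big_ord_recr /=.
  by move: (dS n) IHn; rewrite -/(q n) -/(q n.+1); lra.
have amgm j : 8 * P * q j <=
    (j.+1%:R * (d j - d j.+1)) / 2 + 32 * P ^+ 2 * j.+1%:R^-1.
  have j0 : (j.+1%:R : R) > 0 by rewrite ltr0n.
  rewrite -qq -subr_ge0.
  have -> : j.+1%:R * q j ^+ 2 / 2 + 32 * P ^+ 2 / j.+1%:R - 8 * P * q j =
     (j.+1%:R * q j - 8 * P) ^+ 2 / (2 * j.+1%:R).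
    by field; rewrite addrC natr1 gt_eqF.
  by rewrite divr_ge0 ?sqr_ge0 // mulr_ge0 // ltW.
have abel n : \sum_(j < n) j.+1%:R * (d j - d j.+1) = \sum_(j < n) d j - n%:R * d n.
  elim: n => [|n IHn]; first by rewrite !big_ord0 mul0r subrr.
  by rewrite !big_ord_recr /= IHn -natr1; ring.
have mono n : n%:R * d n <= \sum_(j < n) d j.
  elim: n => [|n IHn]; first by rewrite !big_ord0 mul0r.
  rewrite big_ord_recr /= -natr1 mulrDl mul1r lerD //.
  by apply: le_trans IHn; rewrite ler_wpM2l.
have sumamgm : \sum_(j < k.+1) 8 * P * q j <=
   (\sum_(j < k.+1) d j - k.+1%:R * d k.+1) / 2 + 32 * P ^+ 2 * (2 * ln k.+2%:R).
  apply: (@le_trans _ _ (\sum_(j < k.+1) ((j.+1%:R * (d j - d j.+1)) / 2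
    + 32 * P ^+ 2 * j.+1%:R^-1))); first by apply: ler_sum => j _; exact: amgm.
  rewrite big_split /= -mulr_suml abel -mulr_sumr lerD2l.
  by rewrite ler_wpM2l ?mulr_ge0 ?sqr_ge0 // harmonic_le_ln.
(* Absorbs [E 0 <= P^2] into the logarithm; this adds 2 to the 64 from the harmonic sum, giving
   66. *)
have ln1 : 1 <= 2 * ln (k.+2%:R : R).
  apply: le_trans _ (harmonic_le_ln R k.+1).
  by rewrite big_ord_recl invr1 lerDl sumr_ge0.
have := tele k; have := mono k.+1.
have : 0 <= 4 * P * q k by rewrite !mulr_ge0.
have := E0 k.
have : P ^+ 2 * 1 <= P ^+ 2 * (2 * ln k.+2%:R) by rewrite ler_wpM2l ?sqr_ge0.
move: sumamgm E0P. set S := \sum_(j < _) _; set T := \sum_(j < _) _.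
lra.
Qed.

(** * Quadratic inequalities over the reals *)

Lemma mulr_sqr_ge0 (R : realDomainType) (c x : R) : 0 <= c -> 0 <= c * x ^+ 2.
Proof. by move=> c0; rewrite mulr_ge0 ?sqr_ge0. Qed.

(** Evaluate at [t = C / L], the minimizer once [B] is replaced by [L]; this also covers [B = 0].
    Cauchy-Schwarz and the greedy gain bounds both come from here. *)
Lemma sqr_le_of_quad_ge0 (R : realType) (A B C L : R) :
  0 < L -> B <= L -> (forall t, 0 <= A - 2 * t * C + t ^+ 2 * B) ->
  C ^+ 2 <= L * A.
Proof.
move=> L0 BL quad; rewrite mulrC -ler_pdivrMr // -subr_ge0.
apply: le_trans (quad (C / L)) _.
have -> : A - 2 * (C / L) * C + (C / L) ^+ 2 * B
    = A - C ^+ 2 / L - (C / L) ^+ 2 * (L - B) by field; rewrite gt_eqF.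
by rewrite lerBlDr lerDl mulr_ge0 ?sqr_ge0 // subr_ge0.
Qed.

Lemma normr_le_sqrt (R : realType) (x c y z : R) :
  0 <= c -> x ^+ 2 <= c ^+ 2 * y -> y <= z -> `|x| <= c * Num.sqrt z.
Proof.
move=> c0 xy yz; rewrite -sqrtr_sqr -{1}(ger0_norm c0) -sqrtr_sqr.
rewrite -sqrtrM ?sqr_ge0 // ler_wsqrtr //.
by apply: le_trans xy _; rewrite ler_wpM2l ?sqr_ge0.
Qed.

(** * The coupled quadratic loss on a finite index set *)

Section WeightedLoss.
Context {R : realType} {I : finType}.
Implicit Types (u v w f g h : I -> R).

Definition dotp u v := \sum_i u i * v i.

Definition wdotp w u v := dotp (fun i => w i * u i) v.

Lemma wdotp_ge0 w u : (forall i, 0 <= w i) -> 0 <= wdotp w u u.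
Proof.
by move=> w0; apply: sumr_ge0 => i _; rewrite -mulrA mulr_ge0 // -expr2 sqr_ge0.
Qed.

Lemma le_wdotp w w' u : (forall i, w i <= w' i) -> wdotp w u u <= wdotp w' u u.
Proof.
move=> ww'; apply: ler_sum => i _.
by rewrite -!mulrA ler_wpM2r // -expr2 sqr_ge0.
Qed.

Lemma wdotp_sqr_le w u v (L : R) :
  (forall i, 0 <= w i) -> 0 < L -> wdotp w v v <= L ->
  wdotp w u v ^+ 2 <= L * wdotp w u u.
Proof.
move=> w0 L0 vL; apply: sqr_le_of_quad_ge0 vL _ => // t.
apply: le_trans (wdotp_ge0 (fun i => u i - t * v i) w0) _.
rewrite le_eqVlt; apply/orP; left; apply/eqP.
rewrite /wdotp /dotp !mulr_sumr -sumrB -big_split /=.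
by apply: eq_bigr => i _; ring.
Qed.

(** Duality of l1 and sup norms: gradient bounds on atoms become bounds on comparison points. *)
Lemma dotp_lincomb_le (p : nat) (D : 'I_p -> I -> R) (c : 'I_p -> R) u (s : R) :
  (forall j, `|dotp u (D j)| <= s) ->
  dotp u (fun i => \sum_(j < p) c j * D j i) <= (\sum_(j < p) `|c j|) * s.
Proof.
move=> us.
have -> : dotp u (fun i => \sum_(j < p) c j * D j i)
    = \sum_(j < p) c j * dotp u (D j).
  rewrite /dotp; under eq_bigr do rewrite mulr_sumr.
  rewrite exchange_big; apply: eq_bigr => j _.
  by rewrite mulr_sumr; apply: eq_bigr => i _; ring.
rewrite mulr_suml; apply: ler_sum => j _.
by apply: le_trans (ler_norm _) _; rewrite normrM ler_wpM2l.
Qed.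

(* [a] and [b] are the weights of the labelled and unlabelled points. *)
Variables (a b : I -> R) (lam : R) (Y : I -> R).
Hypotheses (a_ge0 : forall i, 0 <= a i) (b_ge0 : forall i, 0 <= b i).
Hypothesis lam_ge0 : 0 <= lam.

Definition wloss f g := \sum_i
  (a i * (Y i - f i) ^+ 2 + b i * (g i - f i) ^+ 2
   + lam * (a i * (Y i - g i) ^+ 2)).

(* Minus one half of the partial gradients of [wloss]. *)
Definition resf f g i := a i * (Y i - f i) + b i * (g i - f i).
Definition resg f g i := b i * (f i - g i) + lam * (a i * (Y i - g i)).

(** [sqf] and [sqg] are the second-order terms of [wloss] in its two arguments. *)
Definition sqf h := wdotp (fun i => a i + b i) h h.
Definition sqg h := wdotp (fun i => b i + lam * a i) h h.

Let wf_ge0 i : 0 <= a i + b i. Proof. by rewrite addr_ge0. Qed.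
Let wg_ge0 i : 0 <= b i + lam * a i. Proof. by rewrite addr_ge0 ?mulr_ge0. Qed.

Lemma sqf_ge0 h : 0 <= sqf h. Proof. exact: wdotp_ge0. Qed.
Lemma sqg_ge0 h : 0 <= sqg h. Proof. exact: wdotp_ge0. Qed.

Lemma wlossDf f g h t : wloss (fun i => f i + t * h i) g =
  wloss f g - 2 * t * dotp (resf f g) h + t ^+ 2 * sqf h.
Proof.
rewrite /wloss /sqf /wdotp /dotp /resf !mulr_sumr -sumrB -big_split /=.
by apply: eq_bigr => i _; ring.
Qed.

Lemma wlossDg f g h t : wloss f (fun i => g i + t * h i) =
  wloss f g - 2 * t * dotp (resg f g) h + t ^+ 2 * sqg h.
Proof.
rewrite /wloss /sqg /wdotp /dotp /resg !mulr_sumr -sumrB -big_split /=.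
by apply: eq_bigr => i _; ring.
Qed.

(** The two arguments interact only through the weight [b]; this moves a gradient bound from one
    half-step to the next. *)
Lemma resfDg f g g' h : dotp (resf f g) h =
  dotp (resf f g') h - wdotp b (fun i => g' i - g i) h.
Proof.
by rewrite /wdotp /dotp -sumrB; apply: eq_bigr => i _; rewrite /resf; ring.
Qed.

Lemma resgDf f f' g h : dotp (resg f g) h =
  dotp (resg f' g) h - wdotp b (fun i => f' i - f i) h.
Proof.
by rewrite /wdotp /dotp -sumrB; apply: eq_bigr => i _; rewrite /resg; ring.
Qed.

(** A large slope along [h] would allow a large decrease along [h]. With [c] the loss after a greedy
    step, the gain of that step bounds the gradient on atoms. *)
Lemma resf_sqr_le f g h c L : 0 < L -> sqf h <= L ->
  (forall t, c <= wloss (fun i => f i + t * h i) g) ->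
  dotp (resf f g) h ^+ 2 <= L * (wloss f g - c).
Proof.
move=> L0 hL cmin; apply: sqr_le_of_quad_ge0 hL _ => // t.
by have := cmin t; rewrite wlossDf; lra.
Qed.

Lemma resg_sqr_le f g h c L : 0 < L -> sqg h <= L ->
  (forall t, c <= wloss f (fun i => g i + t * h i)) ->
  dotp (resg f g) h ^+ 2 <= L * (wloss f g - c).
Proof.
move=> L0 hL cmin; apply: sqr_le_of_quad_ge0 hL _ => // t.
by have := cmin t; rewrite wlossDg; lra.
Qed.

Lemma resf_min f g h :
  (forall t, wloss f g <= wloss (fun i => f i + t * h i) g) ->
  dotp (resf f g) h = 0.
Proof.
move=> fmin; apply/eqP; rewrite -sqrf_eq0 eq_le sqr_ge0 andbT.
have L0 : 0 < sqf h + 1 by rewrite ltr_wpDl ?sqf_ge0.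
have hL : sqf h <= sqf h + 1 by rewrite lerDl ler01.
by have := resf_sqr_le L0 hL fmin; rewrite subrr mulr0.
Qed.

Lemma resg_min f g h :
  (forall t, wloss f g <= wloss f (fun i => g i + t * h i)) ->
  dotp (resg f g) h = 0.
Proof.
move=> gmin; apply/eqP; rewrite -sqrf_eq0 eq_le sqr_ge0 andbT.
have L0 : 0 < sqg h + 1 by rewrite ltr_wpDl ?sqg_ge0.
have hL : sqg h <= sqg h + 1 by rewrite lerDl ler01.
by have := resg_sqr_le L0 hL gmin; rewrite subrr mulr0.
Qed.

(** Pythagoras: the linear term vanishes at a minimizer along the line through [f] and [f']. *)
Lemma wloss_decrease_f f f' g :
  (forall t, wloss f' g <= wloss (fun i => f' i + t * (f' i - f i)) g) ->
  wloss f g - wloss f' g = sqf (fun i => f' i - f i).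
Proof.
move=> /resf_min res0.
have -> : f = fun i => f' i + (-1) * (f' i - f i) by apply/funext => i; ring.
rewrite wlossDf res0 sqrrN expr1n mul1r.
have -> : (fun i => f' i - (f' i + -1 * (f' i - f i))) = (fun i => f' i - f i).
  by apply/funext => i; ring.
ring.
Qed.

Lemma wloss_decrease_g f g g' :
  (forall t, wloss f g' <= wloss f (fun i => g' i + t * (g' i - g i))) ->
  wloss f g - wloss f g' = sqg (fun i => g' i - g i).
Proof.
move=> /resg_min res0.
have -> : g = fun i => g' i + (-1) * (g' i - g i) by apply/funext => i; ring.
rewrite wlossDg res0 sqrrN expr1n mul1r.
have -> : (fun i => g' i - (g' i + -1 * (g' i - g i))) = (fun i => g' i - g i).
  by apply/funext => i; ring.
ring.
Qed.

(** Convexity: the tangent at the origin lies below the loss. This starts the recursion. *)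
Lemma wloss0_le f g :
  wloss (fun=> 0) (fun=> 0) <= wloss f g
    + 2 * dotp (resf (fun=> 0) (fun=> 0)) f
    + 2 * dotp (resg (fun=> 0) (fun=> 0)) g.
Proof.
rewrite /wloss /dotp !mulr_sumr -!big_split /=; apply: ler_sum => i _.
rewrite /resf /resg -subr_ge0.
have -> : a i * (Y i - f i) ^+ 2 + b i * (g i - f i) ^+ 2
    + lam * (a i * (Y i - g i) ^+ 2)
    + 2 * ((a i * (Y i - 0) + b i * (0 - 0)) * f i)
    + 2 * ((b i * (0 - 0) + lam * (a i * (Y i - 0))) * g i)
    - (a i * (Y i - 0) ^+ 2 + b i * (0 - 0) ^+ 2
       + lam * (a i * (Y i - 0) ^+ 2))
  = a i * f i ^+ 2 + b i * (g i - f i) ^+ 2 + lam * a i * g i ^+ 2 by ring.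
by rewrite !addr_ge0 ?mulr_sqr_ge0 ?mulr_ge0.
Qed.

(* The three- and four-point properties of alternating projections: [f1]
   answers [g0], [g1] answers [f1], and [(f, g)] is the comparison point. *)
Lemma wloss_alternation_le f g f1 g0 g1 :
  dotp (resf f1 g0) f1 = 0 -> dotp (resg f1 g1) g1 = 0 ->
  wloss f1 g1 - wloss f g + sqg (fun i => g i - g1 i)
   <= sqg (fun i => g i - g0 i)
      + 2 * dotp (resf f1 g0) f + 2 * dotp (resg f1 g1) g.
Proof.
move=> resf0 resg0.
(* Subtracting the vanishing terms pairs the gradients with [f - f1] and [g - g1]; the slack is then
   a pointwise sum of squares. *)
suff : wloss f1 g1 - wloss f g + sqg (fun i => g i - g1 i)
   <= sqg (fun i => g i - g0 i)
      + 2 * (dotp (resf f1 g0) f - dotp (resf f1 g0) f1)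
      + 2 * (dotp (resg f1 g1) g - dotp (resg f1 g1) g1).
  by rewrite resf0 resg0 !subr0.
rewrite /wloss /sqg /wdotp /dotp -!sumrB !mulr_sumr -!big_split /=.
apply: ler_sum => i _; rewrite /resf /resg -subr_ge0.
set S := (X in 0 <= X).
have -> : S = a i * (f i - f1 i) ^+ 2 + lam * a i * (g i - g0 i) ^+ 2
    + b i * ((f i - f1 i) - (g i - g0 i)) ^+ 2 by rewrite /S; ring.
by rewrite !addr_ge0 ?mulr_sqr_ge0 ?mulr_ge0.
Qed.

(** * Alternating greedy iterates and their convergence rate *)

Section AlternatingGreedy.
Variables (pf pg : nat) (Df : 'I_pf -> I -> R) (Dg : 'I_pg -> I -> R) (r : R).
Hypotheses (r_ge1 : 1 <= r) (lam_le : lam <= r ^+ 2).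
Hypotheses (sqf_Df : forall p, sqf (Df p) <= 1)
  (sqf_Dg : forall p, sqf (Dg p) <= 1).
Variables F G : nat -> I -> R.
Hypotheses (F0 : F 0%N = fun=> 0) (G0 : G 0%N = fun=> 0).
(** Minimality enters along three kinds of lines: an atom added to the old iterate (gradient
    bounds), the new iterate itself (orthogonality), and the last increment (Pythagoras). *)
Hypothesis F_atom : forall j p t,
  wloss (F j.+1) (G j) <= wloss (fun i => F j i + t * Df p i) (G j).
Hypothesis F_self : forall j t,
  wloss (F j.+1) (G j) <= wloss (fun i => F j.+1 i + t * F j.+1 i) (G j).
Hypothesis F_step : forall j t, wloss (F j.+1) (G j) <=
  wloss (fun i => F j.+1 i + t * (F j.+1 i - F j i)) (G j).
Hypothesis G_atom : forall j p t,
  wloss (F j.+1) (G j.+1) <= wloss (F j.+1) (fun i => G j i + t * Dg p i).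
Hypothesis G_self : forall j t,
  wloss (F j.+1) (G j.+1) <= wloss (F j.+1) (fun i => G j.+1 i + t * G j.+1 i).
Hypothesis G_step : forall j t, wloss (F j.+1) (G j.+1) <=
  wloss (F j.+1) (fun i => G j.+1 i + t * (G j.+1 i - G j i)).

Let L j := wloss (F j) (G j).
Let q j := Num.sqrt (L j - L j.+1).

Let r_ge0 : 0 <= r. Proof. exact: le_trans ler01 r_ge1. Qed.
Let r2_gt0 : 0 < r ^+ 2. Proof. by rewrite exprn_gt0 // (lt_le_trans ltr01). Qed.
Let q_ge0 j : 0 <= q j. Proof. exact: sqrtr_ge0. Qed.

(** A full round decreases the loss by exactly the sum of the two squared steps. *)
Let sqf_step j : sqf (fun i => F j.+1 i - F j i) <= L j - L j.+1.
Proof.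
have := sqg_ge0 (fun i => G j.+1 i - G j i).
rewrite -(wloss_decrease_f (F_step j)) -(wloss_decrease_g (G_step j)) /L; lra.
Qed.

Let sqg_step j : sqg (fun i => G j.+1 i - G j i) <= L j - L j.+1.
Proof.
have := sqf_ge0 (fun i => F j.+1 i - F j i).
rewrite -(wloss_decrease_f (F_step j)) -(wloss_decrease_g (G_step j)) /L; lra.
Qed.

Let L_noninc j : L j.+1 <= L j.
Proof. by rewrite -subr_ge0 (le_trans (sqf_ge0 _) (sqf_step j)). Qed.

(** Pointwise, [b + lam * a <= r^2 * (a + b)], and atoms are normalized for [a + b]. *)
Let sqg_Dg p : sqg (Dg p) <= r ^+ 2.
Proof.
rewrite -[leRHS]mulr1; apply: le_trans (ler_wpM2l (ltW r2_gt0) (sqf_Dg p)).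
rewrite /sqg /sqf /wdotp /dotp mulr_sumr; apply: ler_sum => i _ /=.
have -> : r ^+ 2 * ((a i + b i) * Dg p i * Dg p i)
    = r ^+ 2 * (a i + b i) * Dg p i ^+ 2 by ring.
rewrite -mulrA -expr2 ler_wpM2r ?sqr_ge0 //.
by rewrite mulrDr addrC lerD // ?ler_wpM2r // ler_peMl // exprn_ege1.
Qed.

Let cross_le u v (s : R) : wdotp b u u <= s -> sqf v <= 1 ->
  `|wdotp b u v| <= Num.sqrt s.
Proof.
move=> us v1; rewrite -[Num.sqrt s]mul1r; apply: normr_le_sqrt us => //.
rewrite expr1n; apply: wdotp_sqr_le => //.
by apply: le_trans v1; apply: le_wdotp => i; rewrite lerDr.
Qed.

Let crossF j p : `|wdotp b (fun i => F j.+1 i - F j i) (Dg p)| <= q j.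
Proof.
apply: cross_le => //; apply: le_trans (sqf_step j).
by apply: le_wdotp => i; rewrite lerDr.
Qed.

Let crossG j p : `|wdotp b (fun i => G j.+1 i - G j i) (Df p)| <= q j.
Proof.
apply: cross_le => //; apply: le_trans (sqg_step j).
by apply: le_wdotp => i; rewrite lerDl mulr_ge0.
Qed.

Let resf_atom j p : `|dotp (resf (F j) (G j)) (Df p)| <= q j.
Proof.
rewrite -[q j]mul1r; apply: (@normr_le_sqrt _ _ _ (L j - wloss (F j.+1) (G j))) => //.
  by rewrite expr1n; apply: resf_sqr_le => // t; exact: F_atom.
have := wloss_decrease_g (G_step j); rewrite /L.
by have := sqg_ge0 (fun i => G j.+1 i - G j i); lra.
Qed.

Let resg_half_atom j p : `|dotp (resg (F j.+1) (G j)) (Dg p)| <= r * q j.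
Proof.
apply: (@normr_le_sqrt _ _ _ (wloss (F j.+1) (G j) - L j.+1)) => //.
  by apply: resg_sqr_le => // t; exact: G_atom.
have := wloss_decrease_f (F_step j); rewrite /L.
by have := sqf_ge0 (fun i => F j.+1 i - F j i); lra.
Qed.

(** Going back from [F j.+1] to [F j] costs [q j <= r * q j], hence the 2. *)
Let resg_atom j p : `|dotp (resg (F j) (G j)) (Dg p)| <= 2 * r * q j.
Proof.
rewrite (resgDf _ (F j.+1)); apply: le_trans (ler_normB _ _) _.
apply: le_trans (lerD (resg_half_atom j p) (crossF j p)) _.
have : q j <= r * q j by rewrite ler_peMl.
lra.
Qed.

(** The greedy choice of the following round controls the gradient at [G j.+1], giving [q j.+1];
    returning to [G j] costs [q j]. *)
Let resf_half_atom j p :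
  `|dotp (resf (F j.+1) (G j)) (Df p)| <= q j + q j.+1.
Proof.
rewrite (resfDg _ _ (G j.+1)); apply: le_trans (ler_normB _ _) _.
by rewrite addrC lerD.
Qed.

Variables (cf : 'I_pf -> R) (cg : 'I_pg -> R).
Let f i := \sum_(p < pf) cf p * Df p i.
Let g i := \sum_(p < pg) cg p * Dg p i.
Let Mf := \sum_(p < pf) `|cf p|.
Let Mg := \sum_(p < pg) `|cg p|.

(** Expand one factor of the inner product of [g] with itself over the atoms, apply Cauchy-Schwarz
    to each, then cancel one factor [Num.sqrt (sqg g)]. *)
Let sqg_target : sqg g <= ((Mf + Mg) * r) ^+ 2.
Proof.
have Mf0 : 0 <= Mf by apply: sumr_ge0.
have Mg0 : 0 <= Mg by apply: sumr_ge0.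
have gs : sqg g <= Mg * (r * Num.sqrt (sqg g)).
  apply: dotp_lincomb_le => p; apply: normr_le_sqrt (lexx _) => //.
  exact: (wdotp_sqr_le g wg_ge0 r2_gt0 (sqg_Dg p)).
have [-> |gN0] := eqVneq (sqg g) 0; first exact: sqr_ge0.
have s0 : 0 < Num.sqrt (sqg g) by rewrite sqrtr_gt0 lt0r gN0 sqg_ge0.
have : Num.sqrt (sqg g) <= (Mf + Mg) * r.
  rewrite -(ler_pM2r s0) -expr2 sqr_sqrtr ?sqg_ge0 //.
  by apply: le_trans gs _; rewrite mulrA ler_wpM2r ?ler_wpM2r ?lerDr // ltW.
move=> sM; rewrite -[leLHS]sqr_sqrtr ?sqg_ge0 //.
by rewrite lerXn2r ?nnegrE ?mulr_ge0 ?addr_ge0 // ltW.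
Qed.

Lemma alternating_greedy_rate k : (0 < k)%N ->
  k%:R * (wloss (F k) (G k) - wloss f g)
    <= 66 * ((Mf + Mg) * r) ^+ 2 * ln k.+1%:R.
Proof.
have Mf0 : 0 <= Mf by apply: sumr_ge0.
have Mg0 : 0 <= Mg by apply: sumr_ge0.
pose d j := L j - wloss f g.
have dq j : Num.sqrt (d j - d j.+1) = q j.
  by rewrite /d /q; congr Num.sqrt; ring.
apply: (@perturbed_descent_rate _ d (fun j => sqg (fun i => g i - G j i))).
- by rewrite mulr_ge0 ?addr_ge0.
- by move=> j; rewrite lerD2r.
- by move=> j; exact: sqg_ge0.
- have -> : (fun i => g i - G 0%N i) = g.
    by rewrite G0; apply/funext => i; rewrite subr0.
  exact: sqg_target.
(* The 4 is 2 from the gradient of a square times the 2 of [resg_atom]. *)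
- rewrite dq /d /L F0 G0.
  have fle := dotp_lincomb_le cf (resf_atom 0).
  have gle := dotp_lincomb_le cg (resg_atom 0).
  move: fle gle; rewrite F0 G0 -/Mf -/Mg => fle gle.
  have := wloss0_le f g.
  have : Mf * q 0%N <= Mf * (r * q 0%N) by rewrite ler_wpM2l // ler_peMl.
  have : 0 <= Mf * (r * q 0%N) by rewrite !mulr_ge0.
  move: fle gle; rewrite -/f -/g; lra.
- move=> j; rewrite !dq.
  have := wloss_alternation_le f g (resf_min (F_self j)) (resg_min (G_self j)).
  have := dotp_lincomb_le cf (resf_half_atom j).
  have := dotp_lincomb_le cg (resg_atom j.+1).
  rewrite -/Mf -/Mg -/f -/g -/(L j.+1) -/(d j.+1).
  have : Mf * (q j + q j.+1) <= Mf * (r * (q j + q j.+1)).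
    by rewrite ler_wpM2l // ler_peMl // addr_ge0.
  have : 0 <= Mf * (r * (q j + q j.+1)) by rewrite !mulr_ge0 ?addr_ge0.
  have : 0 <= Mg * (r * q j) by rewrite !mulr_ge0.
  lra.
Qed.

End AlternatingGreedy.

End WeightedLoss.

(** * Spans of finite sequences and greedy selection *)

Section SeqSpan.
Variables (R : realType) (T : Type).
Implicit Types (l : seq (T -> R)) (f h : T -> R).

Lemma seq_span_nil : seq_span [::] (fun=> 0 : R) (T := T).
Proof. by exists (fun=> 0); apply/funext => x; rewrite big_ord0. Qed.

Lemma seq_spanD l f h t :
  seq_span l f -> seq_span l h -> seq_span l (fun x => f x + t * h x).
Proof.
move=> [c ->] [c' ->]; exists (fun j => c j + t * c' j); apply/funext => x.
by rewrite mulr_sumr -big_split; apply: eq_bigr => j _ /=; ring.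
Qed.

Lemma seq_span_rcons l f h t :
  seq_span l f -> seq_span (rcons l h) (fun x => f x + t * h x).
Proof.
move=> [c ->]; exists (fun j => if (j < size l)%N then c j else t).
apply/funext => x; rewrite size_rcons big_ord_recr /= ltnn nth_rcons ltnn eqxx.
by congr (_ + _); apply: eq_bigr => j _; rewrite nth_rcons ltn_ord.
Qed.

End SeqSpan.

Lemma rcons_map_iota (T : Type) (s : nat -> T) k :
  rcons [seq s j | j <- iota 1 k] (s k.+1) = [seq s j | j <- iota 1 k.+1].
Proof. by have := iotaD 1 k 1; rewrite addn1 => ->; rewrite map_cat /= cats1. Qed.

Section GreedyStep.
Variables (R : realType) (T : Type) (p : nat) (D : 'I_p -> T -> R).
(** [obj j] is the loss with the other argument frozen, so both half-steps are instances. *)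
Variables (s : nat -> 'I_p) (h : nat -> T -> R) (obj : nat -> (T -> R) -> R).
Hypothesis h0 : h 0%N = fun=> 0.
Hypothesis h_span : forall j,
  seq_span (rcons [seq D (s i) | i <- iota 1 j] (D (s j.+1))) (h j.+1).
Hypothesis h_min : forall j i h',
  seq_span (rcons [seq D (s i) | i <- iota 1 j] (D i)) h' ->
  obj j (h j.+1) <= obj j h'.

Let span_h j : seq_span [seq D (s i) | i <- iota 1 j] (h j).
Proof.
case: j => [|j]; first by rewrite h0; exact: seq_span_nil.
by rewrite -(rcons_map_iota (fun i => D (s i))); exact: h_span.
Qed.

Lemma greedy_le_atom j i t : obj j (h j.+1) <= obj j (fun x => h j x + t * D i x).
Proof. by apply: h_min; apply: seq_span_rcons. Qed.

Lemma greedy_le_self j t :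
  obj j (h j.+1) <= obj j (fun x => h j.+1 x + t * h j.+1 x).
Proof. by apply: h_min; apply: seq_spanD; exact: h_span. Qed.

Lemma greedy_le_step j t :
  obj j (h j.+1) <= obj j (fun x => h j.+1 x + t * (h j.+1 x - h j x)).
Proof.
apply: h_min; apply: seq_spanD; first exact: h_span.
(* The zero coefficient places the old iterate in the enlarged span. *)
have -> : (fun x => h j.+1 x - h j x) =
    (fun x => h j.+1 x + (-1) * (h j x + 0 * D (s j.+1) x)).
  by apply/funext => x; ring.
by apply: seq_spanD; [exact: h_span | exact: seq_span_rcons].
Qed.

End GreedyStep.

(** * The sample as a weighted index set *)

Section Sample.
Variables (R : realType) (n m : nat).

(** Indicator weights let labelled and unlabelled sums share one index type. *)
Definition lab_weight (i : 'I_(n + m)) : R := (n + m)%:R^-1 * (i < n)%:R.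
Definition unl_weight (i : 'I_(n + m)) : R := (n + m)%:R^-1 * (n <= i)%:R.

Lemma lab_weight_ge0 i : 0 <= lab_weight i.
Proof. by rewrite mulr_ge0 ?invr_ge0. Qed.

Lemma unl_weight_ge0 i : 0 <= unl_weight i.
Proof. by rewrite mulr_ge0 ?invr_ge0. Qed.

Lemma sum_lab (u : nat -> R) :
  (n + m)%:R^-1 * (\sum_(0 <= i < n) u i) = \sum_i lab_weight i * u i.
Proof.
rewrite -(big_mkord xpredT (fun i => (n + m)%:R^-1 * (i < n)%:R * u i)).
rewrite (big_cat_nat (leq0n n) (leq_addr m n)) /= [X in _ + X]big_nat_cond.
rewrite [X in _ + X]big1 ?addr0 => [|i /andP[/andP[ni _] _]]; last first.
  by rewrite ltnNge ni mulr0 mul0r.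
by rewrite mulr_sumr; apply: eq_big_nat => i /andP[_ ->]; rewrite mulr1.
Qed.

Lemma sum_unl (u : nat -> R) :
  (n + m)%:R^-1 * (\sum_(n <= i < n + m) u i) = \sum_i unl_weight i * u i.
Proof.
rewrite -(big_mkord xpredT (fun i => (n + m)%:R^-1 * (n <= i)%:R * u i)).
rewrite (big_cat_nat (leq0n n) (leq_addr m n)) /= [X in X + _]big_nat_cond.
rewrite [X in X + _]big1 ?add0r => [|i /andP[/andP[_ ni] _]]; last first.
  by rewrite leqNgt ni mulr0 mul0r.
by rewrite mulr_sumr; apply: eq_big_nat => i /andP[-> _]; rewrite mulr1.
Qed.

Lemma Lhat_wloss (X W : Type) (lam : R) (Xs : nat -> X) (Ws : nat -> W)
    (Ys : nat -> R) f g :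
  Lhat n m lam Xs Ws Ys f g =
  wloss lab_weight unl_weight lam (fun i => Ys i)
    (fun i => f (Xs i)) (fun i => g (Xs i, Ws i)).
Proof.
rewrite /Lhat !mulrDr sum_lab (sum_unl (fun j => (g (Xs j, Ws j) - f (Xs j)) ^+ 2)).
by rewrite mulrCA sum_lab mulr_sumr -!big_split.
Qed.

Lemma sqf_sample_le1 (T : Type) (pts : nat -> T) (h : T -> R) :
  emp_norm (n + m) pts h <= 1 ->
  sqf lab_weight unl_weight (fun i => h (pts i)) <= 1.
Proof.
move=> h1.
have -> : sqf lab_weight unl_weight (fun i => h (pts i)) =
    (n + m)%:R^-1 * \sum_(i < n + m) h (pts i) ^+ 2.
  rewrite mulr_sumr; apply: eq_bigr => i _.
  by rewrite /= /lab_weight /unl_weight ltnNge; case: (n <= i)%N;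
    rewrite /= mulr1 mulr0 ?addr0 ?add0r -mulrA.
by rewrite -[leLHS]sqr_sqrtr ?expr_le1 ?sqrtr_ge0 // mulr_ge0 ?invr_ge0 //
  sumr_ge0 // => i _; rewrite sqr_ge0.
Qed.

End Sample.

(** * Passage to atomic norms and conclusion *)

Lemma le_atomic_norms (R : realType) (T U : Type) (p q : nat)
    (D : 'I_p -> T -> R) (E : 'I_q -> U -> R) (f : T -> R) (g : U -> R) (t : R) :
  in_span D f -> in_span E g ->
  (forall c c', f = lincomb D c -> g = lincomb E c' ->
    t <= \sum_(i < p) `|c i| + \sum_(i < q) `|c' i|) ->
  t <= atomic_norm D f + atomic_norm E g.
Proof.
move=> [c0 fc0] [c0' gc0'] tle.
(* One infimum at a time; span membership makes each set of coefficient sums nonempty. *)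
rewrite -lerBlDl; apply: lb_le_inf; first by exists (\sum_i `|c0' i|); exists c0'.
move=> _ [c' [gc' ->]]; rewrite lerBlDr addrC -lerBlDr.
apply: lb_le_inf; first by exists (\sum_i `|c0 i|); exists c0.
by move=> _ [c [fc ->]]; rewrite lerBlDr; exact: tle.
Qed.

Theorem theorem3p1 (R : realType) :
  exists C2 : R, 0 < C2 /\
  forall (X W : Type) (lam : R) (n m : nat),
    0 <= lam -> (0 < n)%N -> (0 < m)%N ->
  forall (Xs : nat -> X) (Ws : nat -> W) (Ys : nat -> R)
         (pf : nat) (Df : 'I_pf -> X -> R) (pg : nat) (Dg : 'I_pg -> X * W -> R),
    symmetric_dict Df -> symmetric_dict Dg ->
    (forall i, emp_norm (n + m) Xs (Df i) <= 1) ->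
    (forall i, emp_norm (n + m) (fun j => (Xs j, Ws j)) (Dg i) <= 1) ->
  forall (sf : nat -> 'I_pf) (fs : nat -> X -> R)
         (sg : nat -> 'I_pg) (gs : nat -> X * W -> R),
    AFS_run n m lam Xs Ws Ys Df Dg sf fs sg gs ->
  forall (k : nat), (0 < k)%N ->
  forall (f : X -> R) (g : X * W -> R),
    in_span Df f -> in_span Dg g ->
    Lhat n m lam Xs Ws Ys (fs k) (gs k)
      <= Lhat n m lam Xs Ws Ys f g
         + C2 * (Num.max 1 lam * (atomic_norm Df f + atomic_norm Dg g) ^+ 2
                 * ln (k.+1)%:R / k%:R).
Proof.
exists 66; split; first by rewrite ltr0n.
move=> X W lam n m lam0 _ _ Xs Ws Ys pf Df pg Dg _ _ nDf nDg sf fs sg gs.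
move=> [gs0 run] k k0 f g sp_f sp_g.
(* The run leaves [fs 0] unspecified; the argument starts from [f_0 = 0]. *)
pose hs j := if j is 0%N then fun=> 0 else fs j.
(* Each partial loss differs from [Lhat] by a term constant in the active argument, so its
   minimizers also minimize [Lhat]. *)
have fmin j i h : seq_span (rcons [seq Df (sf i) | i <- iota 1 j] (Df i)) h ->
    Lhat n m lam Xs Ws Ys (hs j.+1) (gs j) <= Lhat n m lam Xs Ws Ys h (gs j).
  have [[_ /(_ i h) le_f] _] := run j.+1 isT.
  by move=> /le_f lef; rewrite /Lhat [leLHS]mulrDr [leRHS]mulrDr lerD2r.
have gmin j i h : seq_span (rcons [seq Dg (sg i) | i <- iota 1 j] (Dg i)) h ->
    Lhat n m lam Xs Ws Ys (hs j.+1) (gs j.+1) <= Lhat n m lam Xs Ws Ys (hs j.+1) h.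
  have [_ [_ /(_ i h) le_g]] := run j.+1 isT.
  move=> /le_g leg; rewrite /Lhat -[X in _ * X <= _]addrA -[X in _ <= _ * X]addrA.
  by rewrite [leLHS]mulrDr [leRHS]mulrDr lerD2l.
have fspan j : seq_span (rcons [seq Df (sf i) | i <- iota 1 j] (Df (sf j.+1))) (hs j.+1).
  by have [[]] := run j.+1 isT.
have gspan j : seq_span (rcons [seq Dg (sg i) | i <- iota 1 j] (Dg (sg j.+1))) (gs j.+1).
  by have [_ []] := run j.+1 isT.
pose r := Num.sqrt (Num.max 1 lam).
have rr : r ^+ 2 = Num.max 1 lam by rewrite sqr_sqrtr // le_max ler01.
have r1 : 1 <= r by rewrite -[leLHS]sqrtr1 ler_wsqrtr // le_max lexx.
have rate c c' : f = lincomb Df c -> g = lincomb Dg c' ->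
    k%:R * (Lhat n m lam Xs Ws Ys (fs k) (gs k) - Lhat n m lam Xs Ws Ys f g)
      <= 66 * ((\sum_i `|c i| + \sum_i `|c' i|) * r) ^+ 2 * ln k.+1%:R.
  move=> -> ->.
  have -> : fs k = hs k by case: (k) k0.
  rewrite !Lhat_wloss.
  apply: (@alternating_greedy_rate _ _ _ _ lam _ (@lab_weight_ge0 R n m)
    (@unl_weight_ge0 R n m) lam0 _ _ (fun p i => Df p (Xs i))
    (fun p i => Dg p (Xs i, Ws i)) r r1 _ _ _
    (fun j i => hs j (Xs i)) (fun j i => gs j (Xs i, Ws i))) => //.
  - by rewrite rr le_max lexx orbT.
  - by move=> p; exact: (sqf_sample_le1 (nDf p)).
  - by move=> p; exact: (sqf_sample_le1 (nDg p)).
  - by rewrite gs0.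
  - by move=> j p t; have := greedy_le_atom (h := hs) erefl fspan fmin j p t;
    rewrite !Lhat_wloss.
  - by move=> j t; have := greedy_le_self fspan fmin j t; rewrite !Lhat_wloss.
  - by move=> j t; have := greedy_le_step (h := hs) erefl fspan fmin j t;
    rewrite !Lhat_wloss.
  - by move=> j p t; have := greedy_le_atom gs0 gspan gmin j p t; rewrite !Lhat_wloss.
  - by move=> j t; have := greedy_le_self gspan gmin j t; rewrite !Lhat_wloss.
  - by move=> j t; have := greedy_le_step gs0 gspan gmin j t; rewrite !Lhat_wloss.
rewrite -lerBlDl.
move: rate; set d := Lhat _ _ _ _ _ _ (fs k) _ - _ => rate.
have kR : 0 < (k%:R : R) by rewrite ltr0n.
have lnk : 0 < ln (k.+1%:R : R) by rewrite ln_gt0 // ltr1n.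
pose K := 66 * (r ^+ 2 * ln k.+1%:R / k%:R).
have K0 : 0 < K by rewrite mulr_gt0 // divr_gt0 // mulr_gt0 // rr lt_max ltr01.
have dK c c' : f = lincomb Df c -> g = lincomb Dg c' ->
    d / K <= (\sum_i `|c i| + \sum_i `|c' i|) ^+ 2.
  move=> fc gc; rewrite ler_pdivrMr // -(ler_pM2l kR).
  apply: le_trans (rate _ _ fc gc) _; rewrite /K le_eqVlt; apply/orP; left; apply/eqP.
  by field; rewrite gt_eqF.
(* The infimum is over unsquared coefficient sums, so the square root is taken first; a negative
   [d / K] is treated separately when squaring back. *)
have tM : Num.sqrt (d / K) <= atomic_norm Df f + atomic_norm Dg g.
  apply: le_atomic_norms => // c c' fc gc.
  have M0 : 0 <= \sum_i `|c i| + \sum_i `|c' i| by rewrite addr_ge0 ?sumr_ge0.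
  by rewrite -[leRHS]ger0_norm // -sqrtr_sqr ler_wsqrtr // dK.
have : d / K <= (atomic_norm Df f + atomic_norm Dg g) ^+ 2.
  have [dK0|dK0] := leP 0 (d / K); last by rewrite (le_trans (ltW dK0)) ?sqr_ge0.
  rewrite -[leLHS](sqr_sqrtr dK0) lerXn2r ?nnegrE ?sqrtr_ge0 //.
  exact: le_trans (sqrtr_ge0 _) tM.
rewrite ler_pdivrMr // => /le_trans; apply.
by rewrite -rr /K le_eqVlt; apply/orP; left; apply/eqP; ring.
Qed.
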